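(* The following congruences hold: (i) $\sigma\mathrm{Mex}(n) \equiv 0 \pmod{2}$ for all integers $n \geq 1$; (ii) $\sigma\mathrm{Mex}(n) \equiv \bar{p}_{\geq 2}(n) \pmod{2^2}$ for all integers $n \geq 0$; (iii) $\sigma_{e}\mathrm{Mex}(n) \equiv 0 \pmod{2^2}$ for all integers $n \geq 0$.
   Context: An overpartition of a non-negative integer $n$ is a partition of $n$ (a finite non-increasing sequence of positive integers with sum $n$) in which the first occurrence of each distinct part may or may not be overlined; the empty overpartition is the only overpartition of $0$. Let $\bar{P}(n)$ be the set of all overpartitions of $n$. For $\lambda\in\bar P(n)$, $\mathrm{Mex}(\lambda)$ is the smallest positive integer that does not occur as a part of $\lambda$, whether overlined or non-overlined (so $\mathrm{Mex}$ of the empty overpartition is $1$). Let $\mathrm{Mex}_e(\lambda)=\mathrm{Mex}(\lambda)$ if $\mathrm{Mex}(\lambda)$ is even, and $\mathrm{Mex}_e(\lambda)=0$ otherwise. Define $\sigma\mathrm{Mex}(n)=\sum_{\lambda\in\bar P(n)}\mathrm{Mex}(\lambda)$ and $\sigma_e\mathrm{Mex}(n)=\sum_{\lambda\in\bar P(n)}\mathrm{Mex}_e(\lambda)$. Let $\bar p_{\geq 2}(n)$ be the number of overpartitions of $n$ all of whose parts are at least $2$ (with $\bar p_{\geq 2}(0)=1$). *)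

(* Defs.v *)
From mathcomp Require Import all_boot.

Set Implicit Arguments.
Unset Strict Implicit.
Unset Printing Implicit Defensive.

(* A sequence of parts, each paired with a mark: [true] means overlined. *)
Definition opseq := seq (nat * bool).

Definition parts (l : opseq) : seq nat := [seq x.1 | x <- l].

Definition marks (l : opseq) : seq bool := [seq x.2 | x <- l].

Definition overlines_first (l : opseq) : bool :=
  all (fun i => nth false (marks l) i ==> (nth 0 (parts l) i \notin take i (parts l)))
      (iota 0 (size l)).

Definition is_overpartition (n : nat) (l : opseq) : bool :=
  [&& sorted geq (parts l), all (fun k => 0 < k) (parts l),
      sumn (parts l) == n & overlines_first l].

(* An overpartition of n has at most n parts, each at most n, so the set of all
   of them is cut out of a finite type; [Pbar_surj] and [opval_inj] show that
   this bound loses nothing and counts nothing twice. *)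
Definition boundedop (n : nat) := n.-bseq ('I_n.+1 * bool).

Definition opval (n : nat) (l : boundedop n) : opseq :=
  [seq (nat_of_ord x.1, x.2) | x <- l].

Definition Pbar (n : nat) : {set boundedop n} :=
  [set l | is_overpartition n (opval l)].

Lemma opval_inj (n : nat) : injective (@opval n).
Proof.
move=> l1 l2 /inj_map eq12; apply: val_inj; apply: eq12.
by case=> [i b] [j c] /= [/val_inj -> ->].
Qed.

Lemma mem_leq_sumn (s : seq nat) (k : nat) : k \in s -> k <= sumn s.
Proof.
elim: s => //= h s IHs; rewrite inE => /predU1P[-> | /IHs le_k].
  exact: leq_addr.
exact: leq_trans le_k (leq_addl _ _).
Qed.

Lemma Pbar_surj (n : nat) (l : opseq) :
  is_overpartition n l -> exists2 m : boundedop n, m \in Pbar n & opval m = l.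
Proof.
move=> lP; have /and4P[_ pos_l /eqP sum_l _] := lP.
have size_le (s : seq nat) : all (fun k => 0 < k) s -> size s <= sumn s.
  elim: s => //= k s IHs /andP[k_gt0 /IHs le_s].
  by rewrite -add1n leq_add.
pose s : seq ('I_n.+1 * bool) := [seq (inord x.1, x.2) | x <- l].
have s_le : size s <= n.
  by rewrite size_map -sum_l -(size_map fst) size_le.
have sE : [seq (nat_of_ord x.1, x.2) | x <- s] = l.
  rewrite -map_comp -[RHS]map_id; apply/eq_in_map => -[k b] kb_l /=.
  rewrite inordK // ltnS -sum_l; apply: mem_leq_sumn.
  by apply/mapP; exists (k, b).
exists (Bseq s_le); last exact: sE.
by rewrite inE /opval /= sE.
Qed.

Lemma exists_missing (l : opseq) : exists k, (0 < k) && (k \notin parts l).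
Proof.
exists (sumn (parts l)).+1; apply/negP => /mem_leq_sumn.
by rewrite ltnn.
Qed.

Definition Mex (l : opseq) : nat := ex_minn (exists_missing l).

Definition Mex_e (l : opseq) : nat := if odd (Mex l) then 0 else Mex l.

Definition sigmaMex (n : nat) : nat := \sum_(l in Pbar n) Mex (opval l).

Definition sigmaMex_e (n : nat) : nat := \sum_(l in Pbar n) Mex_e (opval l).

Definition pbar_ge2 (n : nat) : nat :=
  #|[set l in Pbar n | all (fun k => 2 <= k) (parts (opval l))]|.

(* Main.v *)
Require Import Defs.
From mathcomp Require Import all_boot.

Set Implicit Arguments.
Unset Strict Implicit.
Unset Printing Implicit Defensive.

(** Changing the mark on the first occurrence of a part that occurs is an
  involution without fixed points on overpartitions, and it keeps the parts.
  Applied to the largest part it makes sigmaMex n even for n >= 1.  If 1 is not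
  a part then Mex = 1 and Mex_e = 0, so (ii) and (iii) say that Mex and Mex_e
  sum to 0 modulo 4 over the overpartitions containing 1.  Changing the mark of
  the largest part halves this sum; among the remaining overpartitions, changing
  the mark of 1 halves it again unless all parts are 1, and then Mex = 2. *)

Fixpoint flip (T : Type) (i : nat) (s : seq (T * bool)) : seq (T * bool) :=
  match s, i with
  | [::], _ => [::]
  | x :: r, 0 => (x.1, ~~ x.2) :: r
  | x :: r, j.+1 => x :: flip j r
  end.

Lemma size_flip (T : Type) (i : nat) (s : seq (T * bool)) :
  size (flip i s) = size s.
Proof. by elim: s i => [|x s IHs] [|i] //=; rewrite IHs. Qed.

Lemma flipK (T : Type) (i : nat) : involutive (@flip T i).
Proof.
by move=> s; elim: s i => [|[x b] s IHs] [|i] //=; rewrite ?negbK ?IHs.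
Qed.

(** Polymorphism of [flip] pays off here: the same function acts on a bounded sequence with ordinal
    parts and, through [opval], on the sequence of naturals. *)
Lemma map_flip (T U : Type) (g : T -> U) (i : nat) (s : seq (T * bool)) :
  [seq (g x.1, x.2) | x <- flip i s] = flip i [seq (g x.1, x.2) | x <- s].
Proof. by elim: s i => [|x s IHs] [|i] //=; rewrite IHs. Qed.

Lemma parts_flip (i : nat) (l : opseq) : parts (flip i l) = parts l.
Proof.
rewrite /parts.
by elim: l i => [|x l IHl] [|i] //=; rewrite IHl.
Qed.

Lemma nth_marks_flip (i j : nat) (l : opseq) : i < size l ->
  nth false (marks (flip i l)) j = (i == j) (+) nth false (marks l) j.
Proof.
by rewrite /marks; elim: l i j => [|x l IHl] [|i] [|j] //= /IHl ->.
Qed.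

(** [index] finds the first occurrence of [k], where an overline is always allowed; all other marks
    stay as they were. *)
Lemma overpartition_flip (n k : nat) (l : opseq) : k \in parts l ->
  is_overpartition n l -> is_overpartition n (flip (index k (parts l)) l).
Proof.
move=> kl; have ltl : index k (parts l) < size l.
  by rewrite -(size_map fst) index_mem.
rewrite /is_overpartition parts_flip => /and4P[-> -> ->] /allP over_l /=.
apply/allP => i; rewrite parts_flip size_flip => /over_l.
rewrite nth_marks_flip //; case: eqP => [<- _|//].
rewrite nth_index //; apply/implyP => _; apply/negP => k_in.
by have := index_ltn k_in; rewrite ltnn.
Qed.

(** [h] carries the half of [P] where [b] holds bijectively onto the half where it fails and
    preserves [f], so both halves have the same sum. *)
Lemma sum_involution (T : finType) (P b : pred T) (h : T -> T) (f : T -> nat) :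
    (forall x, P x -> [/\ P (h x), h (h x) = x, b (h x) = ~~ b x
                        & f (h x) = f x]) ->
  \sum_(x | P x) f x = 2 * \sum_(x | P x && ~~ b x) f x.
Proof.
move=> hP; rewrite (bigID b) /= mul2n -addnn; congr (_ + _).
rewrite (reindex_onto h h) /=; last by move=> x /andP[/hP[]].
apply: eq_big => [x|x /andP[/andP[Phx _] /eqP hhx]].
  apply/idP/idP => [/andP[/andP[Phx bhx] /eqP hhx]|/andP[Px nbx]].
    by have [Px _ bx _] := hP _ Phx; move: Px bx; rewrite hhx bhx => -> ->.
  by have [-> -> -> _] := hP _ Px; rewrite nbx eqxx.
by have [_ _ _ fx] := hP _ Phx; rewrite -fx hhx.
Qed.

Lemma bflip_subproof (n i : nat) (l : boundedop n) :
  size (flip i l) <= n.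
Proof. by rewrite size_flip size_bseq. Qed.

Definition bflip (n i : nat) (l : boundedop n) : boundedop n :=
  Bseq (bflip_subproof i l).

Lemma opval_bflip (n i : nat) (l : boundedop n) :
  opval (bflip i l) = flip i (opval l).
Proof. exact: map_flip. Qed.

Definition first_mark (k : nat) (l : opseq) : bool :=
  nth false (marks l) (index k (parts l)).

(** The chosen part [k (parts l)] depends on the parts alone, so a flip does not alter the choice
    and a second flip undoes it. [Q] may look at the marks, which lets the halving be iterated. *)
Lemma sum_flip (n : nat) (k : seq nat -> nat) (Q : pred opseq)
    (f : opseq -> nat) :
    (forall l l', parts l = parts l' -> f l = f l') ->
    (forall l, is_overpartition n l -> Q l ->
       k (parts l) \in parts l
       /\ Q (flip (index (k (parts l)) (parts l)) l)) ->
  \sum_(l in Pbar n | Q (opval l)) f (opval l) =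
  2 * \sum_(l in Pbar n |
             Q (opval l) && ~~ first_mark (k (parts (opval l))) (opval l))
        f (opval l).
Proof.
move=> f_parts kQ.
pose pos (l : opseq) := index (k (parts l)) (parts l).
rewrite (@sum_involution _ _
  (fun l => first_mark (k (parts (opval l))) (opval l))
  (fun l => bflip (pos (opval l)) l)) => [|l /andP[]].
  by congr (2 * _); apply: eq_bigl => l; rewrite andbA.
rewrite !inE => lP Ql; have [kl Qfl] := kQ _ lP Ql.
rewrite !opval_bflip overpartition_flip // Qfl; split=> //.
- by apply: val_inj; rewrite /= /pos parts_flip flipK.
- rewrite /first_mark parts_flip nth_marks_flip ?eqxx //.
  by rewrite -(size_map fst) index_mem.
- by apply: f_parts; rewrite parts_flip.
Qed.

Lemma sum_even (n : nat) (f : opseq -> nat) : 0 < n ->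
    (forall l l', parts l = parts l' -> f l = f l') ->
  2 %| \sum_(l in Pbar n) f (opval l).
Proof.
move=> n_gt0 f_parts.
have := @sum_flip n (head 0) xpredT f f_parts.
under eq_bigl do rewrite andbT.
move=> ->; first by rewrite dvdn_mulr.
move=> l /and4P[_ _ /eqP sum_l _] _; split=> //.
(* [0 < n] rules out the empty overpartition, which has no largest part to flip. *)
by case: (parts l) sum_l n_gt0 => [<- //|m s _ _]; rewrite mem_head.
Qed.

Lemma sum_with_1_dvd4 (n : nat) (f : opseq -> nat) :
    (forall l l', parts l = parts l' -> f l = f l') ->
    (forall l, is_overpartition n l -> 1 \in parts l -> head 0 (parts l) = 1 ->
       ~~ odd (f l)) ->
  4 %| \sum_(l in Pbar n | 1 \in parts (opval l)) f (opval l).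
Proof.
move=> f_parts f_even.
rewrite (@sum_flip n (head 0) (fun l => 1 \in parts l) f f_parts); last first.
  move=> l _; rewrite parts_flip => l1; split=> //.
  by case: (parts l) l1 => // m s _; rewrite mem_head.
rewrite -[4]/(2 * 2) dvdn_pmul2l //.
(* If the largest part is 1, changing the mark of 1 would repeat the first flip, so there the second
   factor 2 comes from the parity of [f]. *)
rewrite (bigID (fun l => head 0 (parts (opval l)) == 1)) /=.
apply: dvdn_add.
  apply: dvdn_sum => l /andP[/andP[lP /andP[l1 _]] /eqP hl].
  by rewrite dvdn2 f_even //; rewrite inE in lP.
(* [Q] records the mark condition left by the first halving. Flipping at 1 preserves it because the
   largest part, differing from 1, has its first occurrence at another index. *)
pose Q l := [&& 1 \in parts l, ~~ first_mark (head 0 (parts l)) l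
              & head 0 (parts l) != 1].
under eq_bigl => l do rewrite -!andbA.
rewrite (@sum_flip n (fun=> 1) Q f f_parts); first by rewrite dvdn_mulr.
move=> l _ /and3P[l1 mark_l head_l]; split=> //.
rewrite /Q /first_mark parts_flip l1 head_l andbT nth_marks_flip; last first.
  by rewrite -(size_map fst) index_mem.
suff /negPf-> : index 1 (parts l) != index (head 0 (parts l)) (parts l) by [].
by case: (parts l) l1 head_l => // m s _ /= /negPf->; rewrite eqxx.
Qed.

Lemma Mex_parts (l l' : opseq) : parts l = parts l' -> Mex l = Mex l'.
Proof. by move=> eq_l; apply: eq_ex_minn => k; rewrite eq_l. Qed.

Lemma Mex_e_parts (l l' : opseq) : parts l = parts l' -> Mex_e l = Mex_e l'.
Proof. by rewrite /Mex_e => /Mex_parts->. Qed.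

Lemma Mex_no1 (l : opseq) : 1 \notin parts l -> Mex l = 1.
Proof.
move=> l1; rewrite /Mex; case: ex_minnP => m /andP[m_gt0 _] min_m.
by apply/eqP; rewrite eqn_leq m_gt0 min_m.
Qed.

Lemma Mex_all1 (n : nat) (l : opseq) : is_overpartition n l ->
  1 \in parts l -> head 0 (parts l) = 1 -> Mex l = 2.
Proof.
move=> /and4P[sorted_l _ _ _] l1 head_l.
(* The parts are non-increasing, so the head bounds them all. *)
have le1 k : k \in parts l -> k <= 1.
  case: (parts l) sorted_l head_l => //= m s path_s m1; move: path_s.
  rewrite m1 inE => path_s /predU1P[-> //|ks].
  have geq_trans : transitive geq.
    by move=> b a c /= le_ba le_cb; exact: leq_trans le_cb le_ba.
  by have /allP/(_ _ ks) := order_path_min geq_trans path_s.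
rewrite /Mex; case: ex_minnP => m /andP[m_gt0 lm] min_m.
apply/eqP; rewrite eqn_leq min_m /=; last by apply/negP => /le1.
by case: m m_gt0 lm {min_m} => [|[|m]] //; rewrite l1.
Qed.

(** Overpartitions without 1 have [Mex] 1 and are merely counted; as parts are positive, they are
    those with all parts at least 2. *)
Lemma sigmaMexE (n : nat) :
  sigmaMex n =
  pbar_ge2 n + \sum_(l in Pbar n | 1 \in parts (opval l)) Mex (opval l).
Proof.
rewrite /sigmaMex (bigID (fun l => 1 \in parts (opval l))) addnC /=.
congr (_ + _); rewrite /pbar_ge2 -sum1_card.
apply: eq_big => [l|l /andP[_ /Mex_no1]//]; rewrite !inE.
apply: andb_id2l => /and4P[_ /allP pos_l _ _].
apply/idP/allP => [l1 k kl|ge2_l]; last by apply/negP => /ge2_l.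
by have := pos_l k kl; case: k kl => [|[|k]] // k1; rewrite k1 in l1.
Qed.

Lemma sigmaMex_eE (n : nat) :
  sigmaMex_e n = \sum_(l in Pbar n | 1 \in parts (opval l)) Mex_e (opval l).
Proof.
rewrite /sigmaMex_e (bigID (fun l => 1 \in parts (opval l))) /=.
rewrite [X in _ + X]big1 ?addn0 // => l /andP[_ /Mex_no1 Mex1].
by rewrite /Mex_e Mex1.
Qed.

Theorem corollary1p6 :
  (forall n : nat, 1 <= n -> sigmaMex n = 0 %[mod 2]) /\
  (forall n : nat, sigmaMex n = pbar_ge2 n %[mod 2 ^ 2]) /\
  (forall n : nat, sigmaMex_e n = 0 %[mod 2 ^ 2]).
Proof.
split=> [n n_gt0|]; last split=> n.
- by apply/eqP; rewrite mod0n; apply: sum_even n_gt0 Mex_parts.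
- rewrite sigmaMexE -modnDmr.
  suff /eqP-> : 4 %| \sum_(l in Pbar n | 1 \in parts (opval l)) Mex (opval l).
    by rewrite addn0.
  apply: sum_with_1_dvd4 Mex_parts _ => l lP l1 head_l.
  by rewrite (Mex_all1 lP l1 head_l).
- apply/eqP; rewrite mod0n sigmaMex_eE; apply: sum_with_1_dvd4 Mex_e_parts _.
  (* [Mex_e] takes only even values, whatever the parts. *)
  by move=> l _ _ _; rewrite /Mex_e; case: ifP => // ->.
Qed.
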